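(* Let $K$ be a compact line (not necessarily separable) and let $L$ be a countable discrete extension of $K$. If $\eta(K,L)<5$, then there is an extension operator $E:C(K)\to C(L)$ with $\|E\|\le 3$.
   Context: All topological spaces are Hausdorff. A compact line is a compact space whose topology is the order topology of some linear order. A countable discrete extension of a compact space $K$ is a compact space $L\supseteq K$ (containing $K$ as a subspace) such that $L\setminus K$ is a countably infinite discrete set. $C(K)$ is the Banach space of real-valued continuous functions on $K$ with the supremum norm. For compact spaces $K\subseteq L$, an extension operator is a bounded linear operator $E:C(K)\to C(L)$ such that $(Ef)|_K=f$ for every $f\in C(K)$. $\eta(K,L)$ denotes the infimum of the norms of all extension operators $E:C(K)\to C(L)$, with $\eta(K,L)=\infty$ if there is no such (bounded) operator. *)

(* Defs.v *)
From HB Require Import structures.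
From mathcomp Require Import all_boot all_order all_algebra.
From mathcomp Require Import all_classical all_reals ereal topology normedtype.

Set Implicit Arguments.
Unset Strict Implicit.
Unset Printing Implicit Defensive.

Import Order.TTheory GRing.Theory Num.Theory.
Import numFieldNormedType.Exports.

Local Open Scope classical_set_scope.
Local Open Scope ring_scope.

Definition ctsfun (R : realType) (K : topologicalType) : Type :=
  continuousType K R.

Section ctsfun_lmodule.
Context {R : realType} {K : topologicalType}.
Implicit Types f g h : ctsfun R K.

HB.instance Definition _ := Choice.on (ctsfun R K).

Lemma ctsfunP f g : f =1 g -> f = g.
Proof. by move=> fg; apply/continuousEP. Qed.

Let zero_cts : continuous (fun _ : K => 0 : R).
Proof. by move=> x; exact: cvg_cst. Qed.

Let opp_cts f : continuous (fun x => - f x : R).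
Proof. by move=> x; apply: cvgN; exact: cts_fun. Qed.

Let add_cts f g : continuous (fun x => f x + g x : R).
Proof. by move=> x; apply: cvgD; exact: cts_fun. Qed.

Let scale_cts (a : R) f : continuous (fun x => a * f x : R).
Proof. by move=> x; apply: cvgM; [exact: cvg_cst|exact: cts_fun]. Qed.

Definition ctsfun_zero : ctsfun R K := mkcts zero_cts.
Definition ctsfun_opp f : ctsfun R K := mkcts (@opp_cts f).
Definition ctsfun_add f g : ctsfun R K := mkcts (@add_cts f g).
Definition ctsfun_scale (a : R) f : ctsfun R K := mkcts (@scale_cts a f).

Let addA : associative ctsfun_add.
Proof. by move=> f g h; apply: ctsfunP => x; exact: addrA. Qed.

Let addC : commutative ctsfun_add.
Proof. by move=> f g; apply: ctsfunP => x; exact: addrC. Qed.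

Let add0 : left_id ctsfun_zero ctsfun_add.
Proof. by move=> f; apply: ctsfunP => x; exact: add0r. Qed.

Let addN : left_inverse ctsfun_zero ctsfun_opp ctsfun_add.
Proof. by move=> f; apply: ctsfunP => x; exact: addNr. Qed.

HB.instance Definition _ :=
  GRing.isZmodule.Build (ctsfun R K) addA addC add0 addN.

Let scaleA a b f : ctsfun_scale a (ctsfun_scale b f) = ctsfun_scale (a * b) f.
Proof. by apply: ctsfunP => x; exact: mulrA. Qed.

Let scale1 : left_id 1 ctsfun_scale.
Proof. by move=> f; apply: ctsfunP => x; exact: mul1r. Qed.

Let scaleDr : right_distributive ctsfun_scale +%R.
Proof. by move=> a f g; apply: ctsfunP => x; exact: mulrDr. Qed.

Let scaleDl f : {morph ctsfun_scale^~ f : a b / a + b}.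
Proof. by move=> a b; apply: ctsfunP => x; exact: mulrDl. Qed.

HB.instance Definition _ :=
  GRing.Zmodule_isLmodule.Build R (ctsfun R K) scaleA scale1 scaleDr scaleDl.

Lemma ctsfun0E x : (0 : ctsfun R K) x = 0.
Proof. by []. Qed.

Lemma ctsfunDE f g x : (f + g) x = f x + g x.
Proof. by []. Qed.

Lemma ctsfunNE f x : (- f) x = - f x.
Proof. by []. Qed.

Lemma ctsfunZE (a : R) f x : (a *: f) x = a * f x.
Proof. by []. Qed.

End ctsfun_lmodule.

(* [sup] is meaningful here only when K is compact; then it is also correct
   for empty K, as sup set0 = 0. *)
Definition supnorm (R : realType) (K : topologicalType) (f : ctsfun R K) : R :=
  sup (range (fun x => `|f x|)).

(* Extended-real valued: an operator is bounded iff its norm is not +oo. *)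
Definition opnorm (R : realType) (K L : topologicalType)
    (E : {linear ctsfun R K -> ctsfun R L}) : \bar R :=
  ereal_sup [set (supnorm (E f))%:E | f in [set f | supnorm f <= 1]].

(* The inclusion of K in L is represented by a topological embedding i. *)
Definition embedding (K L : topologicalType) (i : K -> L) : Prop :=
  injective i /\
  forall U : set K, open U <-> exists2 V : set L, open V & i @^-1` V = U.

Definition countable_discrete_extension (K L : topologicalType) (i : K -> L)
  : Prop :=
  [/\ compact [set: L], hausdorff_space L, embedding i,
      countable (~` range i) /\ infinite_set (~` range i)
    & ~` range i `<=` isolated (~` range i)].

Definition extension_operator (R : realType) (K L : topologicalType)
    (i : K -> L) (E : {linear ctsfun R K -> ctsfun R L}) : Prop :=
  (opnorm E < +oo)%E /\ forall (f : ctsfun R K) (x : K), E f (i x) = f x.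

(* eta(K, L); it is +oo when there is no extension operator, since
   ereal_inf set0 = +oo. *)
Definition ext_eta (R : realType) (K L : topologicalType) (i : K -> L)
  : \bar R :=
  ereal_inf [set opnorm E | E in @extension_operator R K L i].

(* Main.v *)
(** Fix [y] in [L] and let [phi f = E f y], a functional of norm [C < 5] on
    [C(K)]; morally [phi] is a measure with distribution function [F], and for
    continuous [g : K -> [0, 1]] growing from 0 to 1 the number [phi (1 - g)] is
    an average of [F]. Call [g] high if this average exceeds [1 - eps], low if
    it is below [eps]. If [g1 >= g2 >= g3 >= g4] were alternately high, low,
    high, low, then [1 - 2 (g1 - g2 + g3 - g4)] would have norm at most 1 and
    [phi]-value above [5 - 9 eps >= C]. So [F] switches between low and high at
    most three times, say at [a <= b <= c], and [f a - f b + f c] replaces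
    [E f y]. When [y] tends to a point [x] of [K], [phi] tends to the evaluation
    at [x], which forces either [a -> x] and [c - b -> 0], or [c -> x] and
    [b - a -> 0]: the new operator, of norm at most 3, is still an extension
    operator. *)
From HB Require Import structures.
Require Import Defs.
From mathcomp Require Import all_boot all_order all_algebra.
From mathcomp Require Import all_classical all_reals ereal topology normedtype.
From mathcomp Require Import lra.

Set Implicit Arguments.
Unset Strict Implicit.
Unset Printing Implicit Defensive.

Import Order.TTheory GRing.Theory Num.Theory.
Import numFieldNormedType.Exports.
Local Open Scope classical_set_scope.
Local Open Scope ring_scope.

(** * Suprema and separation in compact linear orders *)

Lemma compact_directed_cluster (T : topologicalType) (r : T -> T -> Prop)
    (A : set T) :
    compact [set: T] -> (forall x, r x x) ->
    (forall x y z, r x y -> r y z -> r x z) ->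
    (forall x y, r x y \/ r y x) -> (forall x, closed [set y | r x y]) ->
    A !=set0 ->
  exists2 q, closure A q & forall x, A x -> r x q.
Proof.
move=> cT rr tr tot rc [a0 Aa0].
(* Totality of [r] makes the tails of [A] a proper filter base; a cluster point lies in each closed
   set [[set y | r x y]] with [x] in [A]. *)
pose F := filter_from A (fun x => A `&` [set y | r x y]).
have PF : ProperFilter F.
  apply: filter_from_proper; last by move=> x Ax; exists x; split => /=.
  apply: filter_from_filter; first by exists a0.
  move=> x y Ax Ay; have [h|h] := tot x y.
    by exists y => // z [Az hz]; split; split=> //; apply: tr hz.
  by exists x => // z [Az hz]; split; split=> //; apply: tr hz.
have [q [_ clq]] := cT F PF filterT; exists q.
  by move=> B nB; apply: (clq _ _ _ nB); exists a0 => // z [].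
move=> x Ax; apply: (rc x) => B nB; apply: (clq _ _ _ nB).
by exists x => // z [].
Qed.

Section compact_line.
Context {R : realType} {d : Order.disp_t} {K : orderTopologicalType d}.
Implicit Types (x y z a m : K) (g h : ctsfun R K).

Lemma near_gt x z : (x < z)%O -> \forall y \near z, (x < y)%O.
Proof.
move=> xz; have : open_nbhs z `]x, +oo[%classic.
  by split; [exact: rray_open|rewrite /= in_itv /= xz].
by move=> /open_nbhs_nbhs; apply: filterS => y; rewrite /= in_itv /= andbT.
Qed.

Lemma near_lt x z : (z < x)%O -> \forall y \near z, (y < x)%O.
Proof.
move=> xz; have : open_nbhs z `]-oo, x[%classic.
  by split; [exact: lray_open|rewrite /= in_itv /= xz].
by move=> /open_nbhs_nbhs; apply: filterS => y; rewrite /= in_itv.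
Qed.

Lemma near_left z (U : set K) : nbhs z U ->
  (exists2 u, (u < z)%O & forall t, (u < t)%O -> (t <= z)%O -> U t) \/
  (forall t, (t <= z)%O -> U t).
Proof.
rewrite itv_nbhsE => -[[l r]] [/= ends zlr] sU.
case: l r ends zlr sU => [[] u|[]] [[] v|[]] //= _;
  rewrite in_itv /= ?andbT => zlr sU.
- case/andP: zlr => uz zv; left; exists u => // t ut tz; apply: sU.
  by rewrite /= in_itv /= ut (le_lt_trans tz zv).
- by left; exists u => // t ut tz; apply: sU; rewrite /= in_itv /= ut.
- by right=> t tz; apply: sU; rewrite /= in_itv /= (le_lt_trans tz zlr).
- by right=> t tz; apply: sU; rewrite /= in_itv.
Qed.

Lemma near_right z (U : set K) : nbhs z U ->
  (exists2 v, (z < v)%O & forall t, (t < v)%O -> (z <= t)%O -> U t) \/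
  (forall t, (z <= t)%O -> U t).
Proof.
rewrite itv_nbhsE => -[[l r]] [/= ends zlr] sU.
case: l r ends zlr sU => [[] u|[]] [[] v|[]] //= _;
  rewrite in_itv /= ?andbT => zlr sU.
- case/andP: zlr => uz zv; left; exists v => // t tv zt; apply: sU.
  by rewrite /= in_itv /= tv (lt_le_trans uz zt).
- by right=> t zt; apply: sU; rewrite /= in_itv /= (lt_le_trans zlr zt).
- by left; exists v => // t tv zt; apply: sU; rewrite /= in_itv /= tv.
- by right=> t zt; apply: sU; rewrite /= in_itv.
Qed.

Context (K_compact : compact [set: K]).

Lemma compact_line_sup (k0 : K) (S : set K) : exists q,
  (forall s, S s -> (s <= q)%O) /\
  (forall u, (u < q)%O -> exists2 s, S s & (u < s)%O).
Proof.
(* For empty [S] the supremum is the least element of [K], obtained from compactness and the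
   reversed order. *)
have [->|/set0P S0] := eqVneq S set0.
  have [|||||q _ minq] := @compact_directed_cluster K (fun x y => (y <= x)%O)
    setT K_compact.
  - by [].
  - by move=> x y z yx zy; apply: le_trans yx.
  - by move=> x y; apply/orP; exact: le_total.
  - by move=> x; rewrite -set_itvE; exact: lray_closed.
  - by exists k0.
  - by exists q; split=> // u uq; have := minq u I; rewrite leNgt uq.
have [|||||q clq maxq] := @compact_directed_cluster K (fun x y => (x <= y)%O)
    S K_compact.
- by [].
- by move=> x y z; exact: le_trans.
- by move=> x y; apply/orP; exact: le_total.
- by move=> x; rewrite -set_itvE; exact: rray_closed.
- by [].
- exists q; split=> // u /near_gt /clq [s [Ss us]]; by exists s.
Qed.

(** Points strictly between [a] and [m] serve as [u] and [v] where they exist; at a jump of the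
    order the endpoints do, since a closed ray ending at a jump is also open. *)
Lemma separating_pair a m : (a < m)%O -> exists u v,
  [/\ (u < v)%O, (v <= m)%O, (a <= u)%O,
      (forall z, (z <= a)%O -> \forall y \near z, (y <= u)%O) &
      (forall z, (m <= z)%O -> \forall y \near z, (v <= y)%O)].
Proof.
move=> am.
have [[w /andP[aw wm]]|nw] := pselect (exists w, (a < w < m)%O).
  have right z : (m <= z)%O -> \forall y \near z, (w <= y)%O.
    by move=> mz; near=> y; apply: ltW; near: y; apply/near_gt/(lt_le_trans wm).
  have [[u /andP[au uw]]|nu] := pselect (exists u, (a < u < w)%O).
    exists u, w; split=> //; [exact: ltW|exact: ltW|move=> z za].
    by near=> y; apply: ltW; near: y; apply/near_lt/(le_lt_trans za).
  exists a, w; split=> //; [exact: ltW|move=> z za].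
  near=> y; rewrite leNgt; apply/negP => ay; apply: nu; exists y.
  rewrite ay /=; near: y; exact/near_lt/(le_lt_trans za).
exists a, m; split=> // z h; near=> y; rewrite leNgt; apply/negP => ay.
  apply: nw; exists y; rewrite ay /=; near: y.
  exact/near_lt/(le_lt_trans h).
apply: nw; exists y; rewrite ay andbT; near: y.
exact/near_gt/(lt_le_trans am).
Unshelve. all: by end_near. Qed.

Definition unit_valued g := forall x, 0 <= g x <= 1.

(** Urysohn's lemma for two disjoint closed rays; [g] may fail to be monotone. Quantifying over all
    [t] beyond a nearby [y] makes the conclusions usable at points that merely converge to [z]. *)
Lemma ramp a m : (a < m)%O -> exists g : ctsfun R K, [/\ unit_valued g,
  (forall z, (z <= a)%O -> \forall y \near z, forall t, (t <= y)%O -> g t = 0) &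
  (forall z, (m <= z)%O -> \forall y \near z, forall t, (y <= t)%O -> g t = 1)].
Proof.
move=> am; have [u [v [uv vm au nu nv]]] := separating_pair am.
have /normal_separatorP sepK := compact_normal order_hausdorff K_compact.
have disj : `]-oo, u]%classic `&` `[v, +oo[%classic = set0 :> set K.
  rewrite -subset0 => t [] /=; rewrite !in_itv /= andbT => tu vt.
  by move: (le_lt_trans (le_trans vt tu) uv); rewrite ltxx.
have := sepK R _ _ (@lray_closed _ _ u) (@rray_closed _ _ v) disj.
move=> /(@uniform_separatorP _ R) [f [cf f01 f0 f1]].
exists (mkcts cf : ctsfun R K); split.
- by move=> x; have := f01 (f x) (ex_intro2 _ _ x I erefl); rewrite /= in_itv.
- move=> z /nu; apply: filterS => y yu t ty.
  by apply: (f0 (f t)); exists t => //=; rewrite in_itv /= (le_trans ty yu).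
- move=> z /nv; apply: filterS => y vy t yt.
  by apply: (f1 (f t)); exists t => //=; rewrite in_itv /= (le_trans vy yt).
Qed.

(** Turning the zeros and ones of [g] into plateaus makes the supremum in
    [critical_point] attained without a case analysis on the jumps of [K]. *)
Definition sharpens g g' :=
  (forall x, g x = 0 -> \forall y \near x, g' y = 0) /\
  (forall x, g x = 1 -> \forall y \near x, g' y = 1).

(** The affine map of [0, 1] onto [-e, 1 + e] sends 0 strictly below 0 and 1 strictly above 1.
    Truncating back to [0, 1] therefore gives plateaus there, and no value moves by more than
    [e]. *)
Lemma sharpening (e : R) g : 0 < e -> unit_valued g ->
  exists g' : ctsfun R K,
    [/\ unit_valued g', sharpens g g' & forall x, `|g x - g' x| <= e].
Proof.
move=> e0 g01; pose F x : R := (1 + e *+ 2) * g x - e.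
pose f x : R := Num.min (Num.max (F x) 0) 1.
have cF : continuous F.
  move=> x; apply: cvgB; last exact: cvg_cst.
  by apply: cvgM; [exact: cvg_cst|exact: cts_fun].
have cf : continuous f.
  move=> x; pose max0 y := Num.max (F y) 0.
  apply: (@continuous_min R K max0 (cst 1)); last exact: cst_continuous.
  apply: (@continuous_max R K F (cst 0)); last exact: cst_continuous.
  exact: cF.
have fE x : [/\ 0 <= f x, f x <= 1, F x <= 0 -> f x = 0 & 1 <= F x -> f x = 1].
  rewrite /f /Num.min /Num.max.
  by case: (ltP (F x) 0) => ?; case: ltP => ?; split; try move=> ?; lra.
exists (mkcts cf : ctsfun R K); split.
- by move=> x; have [] := fE x => *; apply/andP.
- split=> x gx.
    have : F x < 0 by rewrite /F gx; lra.
    move=> /(cvgr_lt _ (cF x)); apply: filterS => y Fy.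
    by have [_ _ + _] := fE y; apply; exact: ltW.
  have : 1 < F x by rewrite /F gx; lra.
  move=> /(cvgr_gt _ (cF x)); apply: filterS => y Fy.
  by have [_ _ _] := fE y; apply; exact: ltW.
- move=> x; suff : `|g x - f x| <= e by [].
  have /andP[gx0 gx1] := g01 x.
  have w0 : 0 <= e * g x by rewrite mulr_ge0 // ltW.
  have we : e * g x <= e by rewrite ger_pMr.
  have FE : F x = g x + (e * g x) *+ 2 - e by rewrite /F; lra.
  by rewrite /f ler_norml /Num.max; case: (ltP (F x) 0) => ?; rewrite /Num.min;
    [case: (ltP 0 1)|case: (ltP (F x) 1)] => ?; lra.
Qed.

(** * Extremal points of families stable under sharpening *)

Definition robust (P : set (ctsfun R K)) :=
  forall g, P g -> exists2 g', P g' & sharpens g g'.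

(** Take for [q] the supremum of the set [S] of all [p] such that no member of [P] is 1 on the whole
    ray from [p] on. It belongs to [S]: a member that is 1 from [q] on would, once sharpened, be 1
    from some point of [S] on, or everywhere. If [h] vanishes up to [q], then [h'] vanishes up to
    some [v > q]; as [v] is outside [S], a member of [P] is 1 from [v] on. *)
Lemma critical_point (k0 : K) (P : set (ctsfun R K)) : robust P ->
    (forall g, P g -> exists x, g x <> 1) ->
  exists q : K,
    (forall p, (forall g, P g -> ~ (forall t, (p <= t)%O -> g t = 1)) ->
      (p <= q)%O) /\
    (forall g, P g -> ~ (forall t, (q <= t)%O -> g t = 1)) /\
    (forall h h', sharpens h h' -> (forall t, (t <= q)%O -> h t = 0) ->
      (exists x, h' x <> 0) ->
      exists2 g, P g & forall x, h' x <> 0 -> g x = 1).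
Proof.
move=> rP nP.
pose S := [set p | forall g, P g -> ~ (forall t, (p <= t)%O -> g t = 1)].
have [q [Sq qS]] := compact_line_sup k0 S.
exists q; split; first exact: Sq; split.
  move=> g Pg g1; have [g' Pg' [_ s1]] := rP g Pg.
  have [[u uq ug]|all1] := near_left (s1 q (g1 q (lexx q))).
    have [s Ss us] := qS u uq; apply: (Ss g' Pg') => t st.
    have [tq|qt] := leP t q; first by apply: ug => //; exact: lt_le_trans us st.
    by apply: (nbhs_singleton (s1 t _)); apply/g1/ltW.
  have [x] := nP g' Pg'; apply.
  have [xq|qx] := leP x q; first exact: all1.
  by apply: (nbhs_singleton (s1 x _)); apply/g1/ltW.
move=> h h' [s0 _] h0 [x h'x].
have h'0 t : (t <= q)%O -> h' t = 0.
  by move=> tq; apply: (nbhs_singleton (s0 t _)); exact: h0.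
have [[v qv vh]|all0] := near_right (s0 q (h0 q (lexx q))); last first.
  by have [xq|qx] := leP x q; [have := h'0 x xq|have := all0 x (ltW qx)].
have : ~ S v by move=> /Sq; rewrite leNgt qv.
move=> /existsNP [g /not_implyP[Pg /contrapT g1]].
exists g => // y h'y; apply: g1; rewrite leNgt; apply/negP => yv; apply: h'y.
have [yq|qy] := leP y q; first exact: h'0.
exact: vh _ yv (ltW qy).
Qed.

End compact_line.

(** * Switch points of a single functional *)

Section functional.
Context {R : realType} {d : Order.disp_t} {K : orderTopologicalType d}.
Context (K_compact : compact [set: K]).
Context (phi : {scalar ctsfun R K}) (C eps : R).
Context (phi_bound : forall f : ctsfun R K,
  (forall x, `|f x| <= 1) -> `|phi f| <= C).
Context (eps_le : eps <= 2^-1) (C_le : C <= 5 - 9 * eps).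
Implicit Types (x y z : K) (f g h : ctsfun R K).

Definition one : ctsfun R K := mkcts (@cst_continuous K R 1).

Lemma oneE x : one x = 1.
Proof. by []. Qed.

Context (phi_one : 1 - eps < phi one).

Definition high : set (ctsfun R K) :=
  [set g | unit_valued g /\ 1 - eps < phi (one - g)].

Definition low : set (ctsfun R K) :=
  [set g | unit_valued g /\ phi (one - g) < eps].

Lemma functional_bound (e : R) f : 0 < e -> (forall x, `|f x| <= e) ->
  `|phi f| <= C * e.
Proof.
move=> e0 fe; have -> : f = e *: (e^-1 *: f).
  by rewrite scalerA divff ?scale1r // gt_eqF.
rewrite scalarZ normrM gtr0_norm // mulrC ler_pM2r //.
apply: phi_bound => x; rewrite ctsfunZE normrM gtr0_norm ?invr_gt0 //.
by rewrite mulrC ler_pdivrMr // mul1r.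
Qed.

Lemma functional_sharpening (s : R) g : 0 < s -> unit_valued g ->
  exists g', [/\ unit_valued g', sharpens g g' &
    `|phi (one - g') - phi (one - g)| < s].
Proof.
move=> s0 g01.
have C0 : 0 <= C.
  apply: le_trans (phi_bound (f := 0) _); first exact: normr_ge0.
  by move=> x; rewrite ctsfun0E normr0.
have C1 : 0 < C + 1 by lra.
(* With this precision [phi] changes by at most [C * (s / (C + 1))]; the summand 1 keeps the
   denominator positive and makes this strictly less than [s]. *)
have e0 : 0 < s / (C + 1) by rewrite divr_gt0.
have [g' [g'01 sg gg']] := sharpening e0 g01.
exists g'; split=> //.
have -> : phi (one - g') - phi (one - g) = phi (g - g').
  by rewrite -linearB; congr (phi _); rewrite opprB addrC subrKA.
apply: (le_lt_trans (functional_bound e0 _)).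
  by move=> x; rewrite ctsfunDE ctsfunNE.
by rewrite mulrA ltr_pdivrMr // mulrC ltr_pM2l //; lra.
Qed.

Lemma robust_high : robust high.
Proof.
move=> g [g01 hg].
have s0 : 0 < phi (one - g) - (1 - eps) by rewrite subr_gt0.
have [g' [g'01 sg]] := functional_sharpening s0 g01.
by rewrite ltr_norml => /andP[? ?]; exists g' => //; split=> //; lra.
Qed.

Lemma robust_low : robust low.
Proof.
move=> g [g01 hg].
have s0 : 0 < eps - phi (one - g) by rewrite subr_gt0.
have [g' [g'01 sg]] := functional_sharpening s0 g01.
by rewrite ltr_norml => /andP[? ?]; exists g' => //; split=> //; lra.
Qed.

Lemma robust_vanishing (P : set (ctsfun R K)) (p : K) : robust P ->
  robust (P `&` [set g | forall t, (t <= p)%O -> g t = 0]).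
Proof.
move=> rP g [Pg g0]; have [g' Pg' sg] := rP g Pg; exists g' => //; split=> //.
by move=> t tp; apply: (nbhs_singleton (sg.1 t _)); exact: g0.
Qed.

Lemma low_nonzero g : low g -> exists x, g x <> 0.
Proof.
move=> [_ lg]; apply: contrapT => /forallNP g0; move: lg.
have -> : one - g = one.
  by apply: ctsfunP => x; rewrite ctsfunDE ctsfunNE (contrapT (g0 x)) subr0.
by move=> phi1; move: phi_one eps_le; lra.
Qed.

Lemma high_not_one g : high g -> exists x, g x <> 1.
Proof.
move=> [_ hg]; apply: contrapT => /forallNP g1; move: hg.
have -> : one - g = 0.
  by apply: ctsfunP => x; rewrite ctsfunDE ctsfunNE (contrapT (g1 x)) subrr.
by rewrite linear0; move: eps_le; lra.
Qed.

(** Each function is 1 on the support of the next, which forces g1 >= g2 >= g3 >= g4 without any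
    monotonicity in the variable. The alternating sum then lies in [0, 1], while its [phi]-value is
    below -2 + 4 eps; doubling this and adding [phi one > 1 - eps] gives more than 5 - 9 eps. *)
Lemma no_alternating_chain g1 g2 g3 g4 :
  high g1 -> low g2 -> high g3 -> low g4 ->
  (forall x, g2 x <> 0 -> g1 x = 1) -> (forall x, g3 x <> 0 -> g2 x = 1) ->
  (forall x, g4 x <> 0 -> g3 x = 1) -> False.
Proof.
move=> [u1 h1] [u2 h2] [u3 h3] [u4 h4] r12 r23 r34.
have le_of g h : unit_valued g -> unit_valued h ->
    (forall x, h x <> 0 -> g x = 1) -> forall x, h x <= g x.
  move=> ug uh r x; have [->|/eqP/r ->] := eqVneq (h x) 0.
    by case/andP: (ug x).
  by case/andP: (uh x).
pose f := one - (g1 - g2 + g3 - g4) *+ 2.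
have : `|phi f| <= C.
  apply: phi_bound => x; rewrite ler_norml /f.
  rewrite mulr2n !(ctsfunDE, ctsfunNE, oneE).
  have := le_of _ _ u1 u2 r12 x; have := le_of _ _ u2 u3 r23 x.
  have := le_of _ _ u3 u4 r34 x; have := u1 x; have := u4 x.
  lra.
move=> /ler_normlP[_]; rewrite /f.
have phiB g h : phi (g - h) = phi g - phi h by exact: linearB.
have phiD g h : phi (g + h) = phi g + phi h by exact: linearD.
move: h1 h2 h3 h4; rewrite mulr2n !(phiB, phiD).
move: phi_one C_le; lra.
Qed.

(** Morally, the distribution function is nowhere high before [a], nowhere low between [a] and [b],
    nowhere high between [b] and [c], and nowhere low after [c]. *)
Definition switch_points (a b c : K) := [/\ (a <= b <= c)%O,
  forall g, high g -> ~ (forall t, (a <= t)%O -> g t = 1),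
  forall g, low g -> (forall t, (t <= a)%O -> g t = 0) ->
    ~ (forall t, (b <= t)%O -> g t = 1),
  forall g, high g -> (forall t, (t <= b)%O -> g t = 0) ->
    ~ (forall t, (c <= t)%O -> g t = 1) &
  forall g, low g -> ~ (forall t, (t <= c)%O -> g t = 0)].

(** A greedy choice from left to right: [a], [b] and [c] are successive critical points, each family
    vanishing up to the previous point. Only the last clause of [switch_points] uses the norm
    bound. *)
Lemma switch_points_exist (k0 : K) : exists a b c, switch_points a b c.
Proof.
pose V (p : K) : set (ctsfun R K) := [set g | forall t, (t <= p)%O -> g t = 0].
have VN P p g : (P `&` V p) g -> g p = 0 by move=> [_]; apply.
have notone P p g : (P `&` V p) g -> exists x, g x <> 1.
  by move=> /VN gp; exists p; rewrite gp; apply/eqP; rewrite eq_sym oner_eq0.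
have atp P p g : (P `&` V p) g -> ~ (forall t, (p <= t)%O -> g t = 1).
  move=> /VN gp /(_ p (lexx p)); rewrite gp.
  by apply/eqP; rewrite eq_sym oner_eq0.
have [a [_ [a1 a2]]] := critical_point K_compact k0 robust_high high_not_one.
have [b [ab [b1 b2]]] := critical_point K_compact k0
  (robust_vanishing (p := a) robust_low) (notone low a).
have [c [bc [c1 c2]]] := critical_point K_compact k0
  (robust_vanishing (p := b) robust_high) (notone high b).
exists a, b, c; split.
- by rewrite (ab a) ?(bc b) //; exact: atp.
- exact: a1.
- by move=> g lg ga; apply: b1.
- by move=> g lg ga; apply: c1.
(* A low function vanishing up to [c] is unwound from right to left. Sharpening before each use of a
   critical point gives a predecessor equal to 1 on the support, and the chain [g1], [h2], [h3],
   [h4] is contradictory. *)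
move=> g4 low4 z4.
have [h4 lowh4 s4] := robust_low low4.
have [y h4y] := low_nonzero lowh4.
have [g3 [high3 z3] r34] := c2 _ _ s4 z4 (ex_intro _ y h4y).
have [h3 highh3 s3] := robust_high high3.
have {}r34 x : h4 x <> 0 -> h3 x = 1.
  by move=> /r34 g31; exact: (nbhs_singleton (s3.2 x g31)).
have h3y : h3 y <> 0 by rewrite r34 //; apply/eqP; rewrite oner_eq0.
have [g2 [low2 z2] r23] := b2 _ _ s3 z3 (ex_intro _ y h3y).
have [h2 lowh2 s2] := robust_low low2.
have {}r23 x : h3 x <> 0 -> h2 x = 1.
  by move=> /r23 g21; exact: (nbhs_singleton (s2.2 x g21)).
have h2y : h2 y <> 0 by rewrite r23 //; apply/eqP; rewrite oner_eq0.
have [g1 high1 r12] := a2 _ _ s2 z2 (ex_intro _ y h2y).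
exact: no_alternating_chain high1 lowh2 highh3 lowh4 r12 r23 r34.
Qed.

End functional.

(** * Limits of switch points along ultrafilters *)

Lemma cvg_ultra (T : Type) (V : topologicalType) (F : set_system T)
    (g : T -> V) (l : V) : Filter F ->
  (forall U : set_system T, UltraFilter U -> F `<=` U -> g @ U --> l) ->
  g @ F --> l.
Proof.
move=> FF gU W nW; apply: contrapT => FW.
have PF : ProperFilter (within (~` (g @^-1` W)) F).
  apply: Build_ProperFilter; rewrite /within /=.
  by apply: contra_not FW; apply: filterS => y yW; apply: contrapT.
have [U [UU FU]] := ultraFilterLemma PF.
have UW : U (g @^-1` W).
  by apply: (gU U UU) => // P FP; apply: FU; apply: filterS FP.
have UnW : U (~` (g @^-1` W)) by exact: FU _ (withinT _ FF).
by have [y []] := filter_ex (filterI UW UnW).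
Qed.

(** Switch points are chosen independently for each point of [L] and may oscillate; along an
    ultrafilter compactness makes them converge. *)
Lemma compact_ultra_cvg (T : Type) (V : topologicalType) (F : set_system T)
    (u : T -> V) : compact [set: V] -> UltraFilter F ->
  exists p : V, u @ F --> p.
Proof.
move=> cV UF; have [p [_ clp]] := cV (u @ F) _ filterT; exists p => A nA.
have [//|FnA] := in_ultra_setVsetC (u @^-1` A) UF.
by have [z []] := clp (~` A) A FnA nA.
Qed.

Section limit.
Context {R : realType} {d : Order.disp_t} {K : orderTopologicalType d}.
Context (K_compact : compact [set: K]) (eps : R) (eps_gt0 : 0 < eps).
Context (T : Type) (F : set_system T) {PF : ProperFilter F}.
Context (phi : T -> {scalar ctsfun R K}) (x : K).
Context (phi_cvg : forall f : ctsfun R K, phi y f @[y --> F] --> f x).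
Context (a b c : T -> K) (p q r : K).
Context (a_cvg : a @ F --> p) (b_cvg : b @ F --> q) (c_cvg : c @ F --> r).
Context (abc : \forall y \near F, switch_points (phi y) eps (a y) (b y) (c y)).

Lemma near_high (g : ctsfun R K) : unit_valued g -> g x = 0 ->
  \forall y \near F, high (phi y) eps g.
Proof.
move=> g01 gx; have : 1 - eps < (one - g) x.
  by rewrite ctsfunDE ctsfunNE oneE gx; move: eps_gt0; lra.
by move=> /(cvgr_gt _ (phi_cvg (f := one - g))); apply: filterS => y; split.
Qed.

Lemma near_low (g : ctsfun R K) : unit_valued g -> g x = 1 ->
  \forall y \near F, low (phi y) eps g.
Proof.
move=> g01 gx; have : (one - g) x < eps.
  by rewrite ctsfunDE ctsfunNE oneE gx; move: eps_gt0; lra.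
by move=> /(cvgr_lt _ (phi_cvg (f := one - g))); apply: filterS => y; split.
Qed.

(** The limits satisfy [p <= x <= r], together with [x = p] or [p = q], and
    [q = r] or [x = r]. *)
Lemma switch_limit (f : ctsfun R K) : f p - f q + f r = f x.
Proof.
have absurd (P : T -> Prop) : (\forall y \near F, P y) ->
    (forall y, switch_points (phi y) eps (a y) (b y) (c y) -> ~ P y) -> False.
  move=> nP H; have [y [Sy Py]] := @filter_ex _ F PF _ (filterI abc nP).
  exact: (H y Sy Py).
have ordered (u v : T -> K) s t : u @ F --> s -> v @ F --> t ->
    (forall y, switch_points (phi y) eps (a y) (b y) (c y) -> (u y <= v y)%O) ->
    (s <= t)%O.
  move=> us vt uv; rewrite leNgt; apply/negP => ts.
  have [m [n [mn _ _ nm nn]]] := separating_pair ts.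
  apply: (absurd (fun y => (n <= u y)%O /\ (v y <= m)%O)).
    apply: filterI; first exact: us _ (nn s (lexx s)).
    exact: vt _ (nm t (lexx t)).
  move=> y /uv uvy [nu vm].
  have := le_lt_trans (le_trans (le_trans nu uvy) vm) mn.
  by rewrite ltxx.
have pq : (p <= q)%O by apply: (ordered a b) => // y [/andP[]].
have qr : (q <= r)%O by apply: (ordered b c) => // y [/andP[]].
(* If x < p, a ramp from [x] to [p] is eventually high and equal to 1 from [a y] on, against the
   choice of [a y]. The bound [x <= r] is symmetric, with a low ramp and [c y]. *)
have px : (p <= x)%O.
  rewrite leNgt; apply/negP => xp.
  have [g [g01 g0 g1]] := @ramp R _ _ K_compact _ _ xp.
  have gx := nbhs_singleton (g0 x (lexx x)) x (lexx x).
  have ga : \forall y \near F, forall t, (a y <= t)%O -> g t = 1.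
    exact: a_cvg _ (g1 p (lexx p)).
  by apply: (absurd _ (filterI (near_high g01 gx) ga)) => y [_ + _ _ _] [hg];
    apply.
have xr : (x <= r)%O.
  rewrite leNgt; apply/negP => rx.
  have [g [g01 g0 g1]] := @ramp R _ _ K_compact _ _ rx.
  have gx := nbhs_singleton (g1 x (lexx x)) x (lexx x).
  have gc : \forall y \near F, forall t, (t <= c y)%O -> g t = 0.
    exact: c_cvg _ (g0 r (lexx r)).
  by apply: (absurd _ (filterI (near_low g01 gx) gc)) => y [_ _ _ _ +] [lg];
    apply.
(* Otherwise a ramp from [p] to the minimum of [x] and [q] is eventually low, 0 up to [a y] and 1
   from [b y] on. The next claim mirrors this with a high ramp between [b y] and [c y]. *)
have xpq : (x <= p)%O || (q <= p)%O.
  rewrite -ge_min leNgt; apply/negP => pm.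
  have [g [g01 g0 g1]] := @ramp R _ _ K_compact _ _ pm.
  have gx : g x = 1.
    by apply: (nbhs_singleton (g1 x _)) => //; rewrite ge_min lexx.
  have gq := g1 q; rewrite ge_min lexx orbT in gq.
  have ga : \forall y \near F, forall t, (t <= a y)%O -> g t = 0.
    exact: a_cvg _ (g0 p (lexx p)).
  have gb : \forall y \near F, forall t, (b y <= t)%O -> g t = 1.
    exact: b_cvg _ (gq isT).
  by apply: (absurd _ (filterI (near_low g01 gx) (filterI ga gb))) => y
    [_ _ + _ _] [lg [gay gby]] => /(_ g lg gay); apply.
have qrx : (r <= q)%O || (r <= x)%O.
  rewrite -le_max leNgt; apply/negP => mr.
  have [g [g01 g0 g1]] := @ramp R _ _ K_compact _ _ mr.
  have gx : g x = 0.
    by apply: (nbhs_singleton (g0 x _)) => //; rewrite le_max lexx orbT.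
  have gq := g0 q; rewrite le_max lexx in gq.
  have gb : \forall y \near F, forall t, (t <= b y)%O -> g t = 0.
    exact: b_cvg _ (gq isT).
  have gc : \forall y \near F, forall t, (c y <= t)%O -> g t = 1.
    exact: c_cvg _ (g1 r (lexx r)).
  by apply: (absurd _ (filterI (near_high g01 gx) (filterI gb gc))) => y
    [_ _ _ + _] [hg [gby gcy]] => /(_ g hg gby); apply.
have eq_of u v : (u <= v)%O -> (v <= u)%O -> u = v :> K.
  by move=> uv vu; apply/le_anti; rewrite uv vu.
(* Either p = x and q = r, or p = q and x = r, and two terms cancel; in the mixed cases all four
   points coincide. *)
case/orP: xpq => [xp|qp]; case/orP: qrx => [rq|rx].
- by rewrite -(eq_of p x px xp) -(eq_of q r qr rq) subrK.
- rewrite -(eq_of p x px xp) -(eq_of p q pq (le_trans qr (le_trans rx xp))).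
  by rewrite -(eq_of p r (le_trans pq qr) (le_trans rx xp)) subrK.
- have rp := le_trans rq qp.
  rewrite -(eq_of p q pq qp) -(eq_of p r (le_trans pq qr) rp).
  by rewrite -(eq_of p x px (le_trans xr rp)) subrK.
- by rewrite -(eq_of p q pq qp) -(eq_of x r xr rx) subrr add0r.
Qed.

End limit.

(** * Supremum norms and operator norms *)

Lemma supnorm_ge (R : realType) (K : topologicalType) (f : ctsfun R K) x :
  compact [set: K] -> `|f x| <= supnorm f.
Proof.
move=> cK; apply: ub_le_sup; last by exists x.
have /compact_bounded [M [_ /(_ (M + 1))]] : compact (f @` setT).
  apply: continuous_compact => //.
  by apply: continuous_subspaceT => y; exact: cts_fun.
move=> fM; exists (M + 1) => _ [y _ <-].
by apply: fM; [rewrite ltrDl|exists y].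
Qed.

Lemma supnorm_le (R : realType) (K : topologicalType) (f : ctsfun R K)
    (M : R) (k0 : K) : (forall x, `|f x| <= M) -> supnorm f <= M.
Proof.
move=> fM; apply: ge_sup; first by exists `|f k0|; exists k0.
by move=> _ [x _ <-].
Qed.

Section opnorm.
Context {R : realType} {K L : topologicalType}.

Lemma opnorm_le (E : {linear ctsfun R K -> ctsfun R L}) (M : R) (l0 : L) :
  compact [set: K] ->
  (forall f : ctsfun R K, (forall x, `|f x| <= 1) -> forall y, `|E f y| <= M) ->
  (opnorm E <= M%:E)%E.
Proof.
move=> cK EM; apply: ge_ereal_sup => _ [f f1 <-].
rewrite lee_fin; apply: supnorm_le => //; apply: EM => x.
exact: le_trans (supnorm_ge f x cK) f1.
Qed.

Lemma opnorm_bound (E : {linear ctsfun R K -> ctsfun R L}) (M : R) (k0 : K) :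
  compact [set: L] -> (opnorm E < M%:E)%E ->
  exists2 C, C < M &
    forall f : ctsfun R K, (forall x, `|f x| <= 1) -> forall y, `|E f y| <= C.
Proof.
move=> cL EM; have bound (f : ctsfun R K) : (forall x, `|f x| <= 1) ->
    ((supnorm (E f))%:E <= opnorm E)%E.
  by move=> f1; apply: ereal_sup_ubound; exists f => //; exact: supnorm_le.
case: (opnorm E) EM bound => [C||] //= EM bound.
  exists C; first by rewrite -lte_fin.
  move=> f f1 y; apply: le_trans (supnorm_ge (E f) y cL) _.
  by rewrite -lee_fin; exact: bound.
(* The value -oo is impossible because the zero function lies in the unit ball. *)
suff : ((supnorm (E 0))%:E <= -oo)%E by [].
by apply: bound => x; rewrite ctsfun0E normr0.
Qed.

End opnorm.

(** * Construction of the extension operator *)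

Section evaluation.
Context {R : realType} {K L : topologicalType}.
Context (E : {linear ctsfun R K -> ctsfun R L}) (y : L).

Definition eval_at (f : ctsfun R K) : R := E f y.

Let eval_at_linear : scalar eval_at.
Proof. by move=> k f g; rewrite /eval_at linearP. Qed.

HB.instance Definition _ :=
  GRing.isLinear.Build R (ctsfun R K) R *%R eval_at eval_at_linear.

End evaluation.

Section three_point_operator.
Context {R : realType} {K L : topologicalType} (a b c : L -> K).
Context (abc_continuous : forall f : ctsfun R K,
  continuous (fun y => f (a y) - f (b y) + f (c y) : R)).

(** Continuity is asked of the combination only: [a], [b] and [c] will be arbitrary choices of
    switch points. *)
Definition three_point_op (f : ctsfun R K) : ctsfun R L :=
  mkcts (@abc_continuous f).

Let three_point_op_linear : linear three_point_op.
Proof.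
move=> k f g; apply: ctsfunP => y; rewrite ctsfunDE ctsfunZE.
change (k * f (a y) + g (a y) - (k * f (b y) + g (b y)) +
  (k * f (c y) + g (c y)) = k * (f (a y) - f (b y) + f (c y)) +
  (g (a y) - g (b y) + g (c y))); lra.
Qed.

HB.instance Definition _ :=
  GRing.isLinear.Build R (ctsfun R K) (ctsfun R L) *:%R three_point_op
    three_point_op_linear.

End three_point_operator.

Section extension.
Context {K L : topologicalType} {i : K -> L}.

Lemma embedding_continuous : embedding i -> continuous i.
Proof. by move=> [_ io]; apply/continuousP => V oV; apply/io; exists V. Qed.

(** The image of the compact space [K] is closed in the Hausdorff space [L], so a point isolated in
    the complement is isolated in [L]. *)
Lemma nbhs_discrete_part (y : L) : compact [set: K] ->
  countable_discrete_extension i -> (~` range i) y -> nbhs y [set y].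
Proof.
move=> cK [_ hL emb _ iso] iy; have [_ [V nV VD]] := iso y iy.
rewrite -VD; apply: filterI => //; apply: open_nbhs_nbhs; split => //.
apply: closed_openC; apply: compact_closed => //.
apply: continuous_compact => //; apply: continuous_subspaceT.
exact: embedding_continuous.
Qed.

End extension.

Theorem theorem3p3 (R : realType) (d : Order.disp_t)
    (K : orderTopologicalType d) (L : topologicalType) (i : K -> L)
    (K_compact : compact [set: K])
    (L_ext : countable_discrete_extension i)
    (eta_lt5 : (ext_eta R i < 5%:E)%E) :
  exists E : {linear ctsfun R K -> ctsfun R L},
    extension_operator i E /\ (opnorm E <= 3%:E)%E.
Proof.
have [cL _ _ [_ infD] _] := L_ext.
have [l0 _] := infinite_setN0 infD.
suff [E [Ei EM]] : exists E : {linear ctsfun R K -> ctsfun R L},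
    (forall (f : ctsfun R K) x, E f (i x) = f x) /\
    (forall f : ctsfun R K, (forall x, `|f x| <= 1) -> forall y, `|E f y| <= 3).
  have E3 : (opnorm E <= 3%:E)%E by apply: opnorm_le EM.
  by exists E; split=> //; split=> //; apply: le_lt_trans E3 (ltry _).
have [[k0 _]|K0] := pselect (exists k0 : K, True); last first.
  exists (\0 : {linear ctsfun R K -> ctsfun R L}); split.
    by move=> f x; case: K0; exists x.
  by move=> f _ y; change (`|0 : R| <= 3); rewrite normr0.
have [_ [E [_ Ei] <-] /(opnorm_bound k0 cL) [C C5 EC]] := ereal_inf_lt eta_lt5.
(* The first bound yields C <= 5 - 9 eps; the second keeps high and low apart. *)
pose eps : R := Num.min ((5 - C) / 9) 2^-1.
have eps0 : 0 < eps.
  by rewrite lt_min invr_gt0 ltr0n divr_gt0 // ?subr_gt0 // ltr0n.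
have eps2 : eps <= 2^-1 by rewrite ge_min lexx orbT.
have epsC : C <= 5 - 9 * eps.
  have : eps <= (5 - C) / 9 by rewrite ge_min lexx.
  by rewrite ler_pdivlMr ?ltr0n //; lra.
pose phi y : {scalar ctsfun R K} := eval_at E y.
(* The default triple is harmless: [phi y one] tends to 1 at points of [K], so it occurs only away
   from them. *)
have points y : exists t : K * K * K, 1 - eps < phi y one ->
    switch_points (phi y) eps t.1.1 t.1.2 t.2.
  have [y1|y1] := pselect (1 - eps < phi y one); last by exists (k0, k0, k0).
  have bound (f : ctsfun R K) (f1 : forall x, `|f x| <= 1) : `|phi y f| <= C.
    exact: EC.
  have [a [b [c H]]] := switch_points_exist K_compact bound eps2 epsC y1 k0.
  by exists (a, b, c).
have [abc abcP] := choice points.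
pose a y := (abc y).1.1; pose b y := (abc y).1.2; pose c y := (abc y).2.
pose G (f : ctsfun R K) y : R := f (a y) - f (b y) + f (c y).
have G_cvg f x : G f @ nbhs (i x) --> f x.
  apply: cvg_ultra => U UU nU.
  have [p ap] := compact_ultra_cvg a K_compact UU.
  have [q bq] := compact_ultra_cvg b K_compact UU.
  have [r cr] := compact_ultra_cvg c K_compact UU.
  have phiU (g : ctsfun R K) : phi y g @[y --> U] --> g x.
    rewrite -Ei; apply: cvg_trans (@cts_fun _ _ (E g) (i x)).
    by move=> A /nU.
  have U1 : \forall y \near U, switch_points (phi y) eps (a y) (b y) (c y).
    have : 1 - eps < one x by rewrite oneE; lra.
    by move=> /(cvgr_gt _ (phiU one)); apply: filterS => y; exact: abcP.
  rewrite -(switch_limit K_compact eps0 phiU ap bq cr U1 f).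
  have fU (u : L -> K) s : u @ U --> s -> f (u y) @[y --> U] --> f s.
    by move=> us; apply: (cvg_comp _ _ us); exact: cts_fun.
  by apply: cvgD; [apply: cvgB|]; exact: fU.
(* Since [i x] lies in each of its own neighbourhoods, the limit in [G_cvg] must equal the value at
   [i x]. The three-point formula thus serves on [K] as well. *)
have G_i f x : G f (i x) = f x.
  apply/eqP; rewrite eq_sym; apply/eqP; apply: Rhausdorff => A B nA nB.
  exists (G f (i x)); split; last exact: nbhs_singleton.
  exact: nbhs_singleton (G_cvg f x A nA).
have G_cts f : continuous (G f).
  move=> y; have [[x _ <-]|iy] := pselect (range i y).
    by rewrite /continuous_at G_i; exact: G_cvg.
  move=> A /nbhs_singleton Ay.
  by apply: filterS (nbhs_discrete_part K_compact L_ext iy) => z ->.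
exists (three_point_op G_cts); split; first exact: G_i.
move=> f f1 y; have := f1 (a y); have := f1 (b y); have := f1 (c y).
suff : `|f (c y)| <= 1 -> `|f (b y)| <= 1 -> `|f (a y)| <= 1 -> `|G f y| <= 3.
  by [].
by rewrite /G !ler_norml; lra.
Qed.
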